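(* Let $(X,d)$ be a compact metric space with finite box-counting dimension $d_B(X)$. Then for any integer $k>2d_B(X)$ and any given $\theta$ with $$0<\theta<\frac{k-2d_B(X)}{k\,(1+d_B(X))\left(1+\frac{d_B(X)}{2}\right)},$$ there exist a Lipschitz map $\psi:(X,d)\to\mathbb{R}^k$ and a constant $C_\psi>0$ such that $$d(x,y)\le C_\psi\,|\psi(x)-\psi(y)|^{\theta}\qquad\text{for all }x,y\in X.$$
   Context: $|\cdot|$ is the Euclidean norm on $\mathbb{R}^k$. Box-counting dimension: $d_B(X)=\limsup_{\epsilon\to0}\frac{\log N(X,\epsilon)}{-\log\epsilon}$, where $N(X,\epsilon)$ is the minimum number of balls of radius $\epsilon$ with centres in $X$ required to cover $X$. *)

(* Defs.v *)
From HB Require Import structures.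
From mathcomp Require Import all_boot all_order all_algebra finmap.
From mathcomp Require Import all_classical all_reals all_analysis.

Set Implicit Arguments.
Unset Strict Implicit.
Unset Printing Implicit Defensive.

Import Order.TTheory GRing.Theory Num.Theory.
Import numFieldTopology.Exports numFieldNormedType.Exports.

Local Open Scope classical_set_scope.
Local Open Scope ring_scope.

(* [ball c e] is the open ball [mdist c x < e].  The cardinals form a set of
   naturals, so the infimum is a minimum when a finite cover exists, and it is
   [+oo] otherwise. *)
Definition covering_number (R : realType) (X : metricType R) (e : R) : \bar R :=
  ereal_inf [set (#|` A|%fset%:R)%:E |
    A in [set A : {fset X} | [set: X] `<=` \bigcup_(c in [set` A]) ball c e]].

(* [lne 0 = -oo], so the empty space has dimension [-oo]; a nonempty space has
   dimension in [[0, +oo]]. *)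
Definition box_dim (R : realType) (X : metricType R) : \bar R :=
  limf_esup (fun e : R => lne (covering_number X e) * ((- ln e)^-1)%:E)%E
    ((0 : R)^'+).

(* The library norm on ['rV[R]_k] is the sup norm. *)
Definition euclidean_norm (R : realType) (k : nat) (v : 'rV[R]_k) : R :=
  Num.sqrt (\sum_(i < k) v 0 i ^+ 2).

(* The library's [lipschitz] requires a normed module as domain. *)
Definition lipschitz_map (R : realType) (X : metricType R) (k : nat)
    (f : X -> 'rV[R]_k) : Prop :=
  exists2 L : R, 0 <= L &
    forall x y : X, euclidean_norm (f x - f y) <= L * mdist x y.

(* Main.v *)
(* Fix dB < s < s', let eps_n = 2^-n and delta_n = eps_n^(1/theta), and let A_n
   be an (eps_n / 8)-net and B_n a delta_n-net.  The components of the map are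
   sums over n and a in A_n of c * w_n * d(., a), with independent random
   coefficients c in [0, 1] and w_n = eps_n^s', which makes the sums uniformly
   Lipschitz.  For p, q at distance about eps_n, the coefficient of a point of
   A_n close to p alone puts all k components of the difference within a
   multiple of delta_n of 0 with probability at most a constant times
   (delta_n / (w_n eps_n))^k.  A union bound over the pairs of B_n and over all
   small scales works when theta < (k - 2 s) / (k (1 + s')); for s, s' close to
   dB this follows from the hypothesis, even without its factor 1 + dB / 2.
   To stay within finite probability spaces, the coefficients range over a
   finite grid, only M scales are treated at a time, and M tends to infinity
   along an ultrafilter; the bounds do not depend on M. *)
Require Import Defs.
From HB Require Import structures.
From mathcomp Require Import all_boot all_order all_algebra finmap.
From mathcomp Require Import all_classical all_reals all_analysis.
From mathcomp Require Import ring lra.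

Set Implicit Arguments.
Unset Strict Implicit.
Unset Printing Implicit Defensive.

Import Order.TTheory GRing.Theory Num.Theory.
Import numFieldTopology.Exports numFieldNormedType.Exports.

Local Open Scope ring_scope.

(** * Counting on finite grids of coefficients *)

(** Conditioning on all coordinates but [i0]: the proportion of [E] is at most the average over [c]
    of the proportion of values at [i0] that lead into [E]. *)
Lemma card_fibers_le (I : finType) (Q : nat) (i0 : I)
    (E : {set {ffun I -> 'I_Q}}) :
  (#|E| * Q <= \sum_(c : {ffun I -> 'I_Q})
     #|[set u | [ffun i => if i == i0 then u else c i] \in E]|)%N.
Proof.
pose upd (c : {ffun I -> 'I_Q}) (u : 'I_Q) : {ffun I -> 'I_Q} :=
  [ffun i => if i == i0 then u else c i].
pose D := [set p : {ffun I -> 'I_Q} * 'I_Q | upd p.1 p.2 \in E].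
have -> : (#|E| * Q = #|finset.setX E [set: 'I_Q]|)%N.
  by rewrite cardsX cardsT card_ord.
(* Exchanging [u] with the value at [i0] embeds E x 'I_Q into D. *)
pose swap (p : {ffun I -> 'I_Q} * 'I_Q) := (upd p.1 p.2, p.1 i0).
have swapK : involutive swap.
  case=> c u; rewrite /swap /= ffunE eqxx; congr (_, _).
  by apply/ffunP => i; rewrite !ffunE; case: eqP => // ->.
have sub : swap @: finset.setX E [set: 'I_Q] \subset D.
  apply/fintype.subsetP => _ /imsetP[[c u] + ->]; rewrite !inE /= andbT => cE.
  suff -> : upd (upd c u) (c i0) = c by [].
  by apply/ffunP => i; rewrite !ffunE; case: eqP => // ->.
rewrite -(card_imset _ (inv_inj swapK)).
apply: leq_trans (subset_leq_card sub) _.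
rewrite -sum1_card (eq_bigl (fun p => true && (upd p.1 p.2 \in E))); last first.
  by move=> p; rewrite inE.
rewrite -(pair_big_dep xpredT (fun c u => upd c u \in E) (fun _ _ => 1%N)) /=.
apply/eq_leq/eq_bigr => c _; rewrite -sum1_card.
by apply: eq_bigl => u; rewrite inE.
Qed.

Lemma card_ord_close (R : realDomainType) (Q : nat) (S : {set 'I_Q}) (len : R) :
  0 <= len -> {in S &, forall u v : 'I_Q, `|u%:R - v%:R| <= len} ->
  #|S|%:R <= len + 1.
Proof.
move=> len0 Slen; have [->|[u0 Su0]] := set_0Vmem S.
  by rewrite cards0; lra.
pose a := [arg min_(i < u0 in S) val i].
pose b := [arg max_(i > u0 in S) val i].
have [aS amin] : a \in S /\ forall u, u \in S -> (a <= u)%N.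
  by rewrite /a; case: arg_minnP.
have [bS bmax] : b \in S /\ forall u, u \in S -> (u <= b)%N.
  by rewrite /b; case: arg_maxnP.
have cardS : (#|S| <= (b - a).+1)%N.
  have sub : {subset [seq val u | u <- enum S] <= iota a (b - a).+1}.
    move=> _ /mapP[u + ->]; rewrite mem_enum mem_iota => uS.
    by rewrite amin // addnS ltnS subnKC ?bmax // amin.
  have := uniq_leq_size _ sub; rewrite size_iota size_map -cardE; apply.
  by rewrite map_inj_uniq ?enum_uniq //; exact: val_inj.
apply: le_trans (_ : (b - a).+1%:R <= _); first by rewrite ler_nat.
rewrite -natr1 lerD2r natrB ?amin //.
by apply: le_trans (Slen _ _ bS aS); exact: ler_norm.
Qed.

(** The union bound in counting form: if the [B j] covered [T], each point would be counted at least
    once. *)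
Lemma exists_notin_union (T : finType) (J : eqType) (s : seq J)
    (B : J -> {set T}) :
  (\sum_(j <- s) #|B j| < #|T|)%N ->
  exists x, {in s, forall j, x \notin B j}.
Proof.
move=> cardB.
suff /existsP[x /allP xP] : [exists x, all (fun j => x \notin B j) s].
  by exists x.
apply: contraTT cardB => /existsPn cover; rewrite -leqNgt.
under eq_bigr do rewrite -sum1_card big_mkcond /=.
rewrite exchange_big -sum1_card /=; apply: leq_sum => x _.
have /allPn[j js] := cover x; rewrite negbK => xB.
by rewrite (big_rem j) //= xB.
Qed.

(** Take the coefficients uniform on a grid of step [1 / Q]. With all but the one at [i0] fixed, the
    values that bring the sum below [t j] in absolute value lie in an interval of length at most
    [2 * t j / tau j], so this has probability at most [3 * t j / tau j] on a fine grid.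
    Independence of the [k] rows gives the power [k], and the last hypothesis is the union bound. *)
Lemma exists_coefficients (R : archiRealFieldType) (k : nat) (I : finType)
    (J : eqType) (s : seq J) (v : J -> I -> R) (t tau : J -> R) :
  {in s, forall j, 0 < t j} -> {in s, forall j, 0 < tau j} ->
  {in s, forall j, exists i, tau j <= `|v j i|} ->
  \sum_(j <- s) (3 * t j / tau j) ^+ k < 1 ->
  exists c : 'I_k -> I -> R, (forall l i, 0 <= c l i <= 1) /\
    {in s, forall j, exists l, t j <= `|\sum_i c l i * v j i|}.
Proof.
move=> t0 tau0 vtau small.
(* [S] bounds every ratio [tau j / t j] with [j] in [s]. Hence [Q > S] gives [1 <= t j * Q / tau j],
   which later absorbs the [+ 1] of the integer count and turns the factor 2 into 3. *)
pose S := \sum_(j <- s | (0 < t j) && (0 < tau j)) tau j / t j.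
have S0 : 0 <= S by apply: sumr_ge0 => j /andP[? ?]; rewrite ltW // divr_gt0.
pose Q := (Num.bound S).
have QS : S < Q%:R by exact: archi_boundP.
have Q0 : 0 < Q%:R :> R by exact: le_lt_trans S0 QS.
have tauQ : {in s, forall j, 1 <= t j * Q%:R / tau j}.
  move=> j js; have tj := t0 j js; have tauj := tau0 j js.
  rewrite ler_pdivlMr // mul1r mulrC -ler_pdivrMr //; apply: le_trans (ltW QS).
  rewrite /S (big_rem j) //= tj tauj /= lerDl sumr_ge0 // => i /andP[? ?].
  by rewrite ltW // divr_gt0.
pose val (f : {ffun I -> 'I_Q}) i : R := (f i)%:R / Q%:R.
pose E j := [set f | `|\sum_i val f i * v j i| < t j].
have cardE : {in s, forall j,
    #|E j|%:R <= 3 * t j / tau j * #|{ffun I -> 'I_Q}|%:R}.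
  move=> j js; have tj := t0 j js; have tauj := tau0 j js.
  have [i0 vi0] := vtau j js; rewrite -(ler_pM2r Q0) -natrM.
  have := card_fibers_le i0 (E j); rewrite -(ler_nat R) => /le_trans; apply.
  rewrite natr_sum.
  apply: le_trans (_ : \sum_(c : {ffun I -> 'I_Q}) 3 * t j / tau j * Q%:R <= _);
    last by rewrite sumr_const -[leLHS]mulr_natr mulrAC lexx.
  apply: ler_sum => c _.
  have v0 : 0 < `|v j i0| by exact: lt_le_trans vi0.
  apply: le_trans (_ : 2 * (t j * Q%:R / tau j) + 1 <= _); last first.
    have -> : 3 * t j / tau j * Q%:R = 3 * (t j * Q%:R / tau j) by ring.
    by have := tauQ j js; lra.
  apply: card_ord_close => [|u w].
    by rewrite mulr_ge0 // ltW // !mulr_gt0 // invr_gt0.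
  rewrite !inE => uE wE.
  (* The two coefficient families differ at [i0] only, so all other terms cancel in the difference
     of the sums. *)
  have : `|(u%:R - w%:R) / Q%:R * v j i0| < 2 * t j.
    rewrite mulr_natl mulr2n; apply: le_lt_trans (ltrD uE wE).
    apply: le_trans (ler_normB _ _); rewrite -sumrB (bigD1 i0) //= big1 => [|i].
      by rewrite addr0 /val !ffunE eqxx -mulrBl -mulrBl.
    by move=> /negbTE ii0; rewrite /val !ffunE ii0 subrr.
  rewrite !normrM normfV [ `|Q%:R| ]gtr0_norm // mulrAC ltr_pdivrMr // => close.
  rewrite !mulrA ler_pdivlMr // (le_trans _ (ltW close)) //.
  by rewrite ler_wpM2l.
(* The event that all [k] rows fail to separate [j]. *)
pose B j := [set g : {ffun 'I_k -> {ffun I -> 'I_Q}} |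
             g \in ffun_on (mem (E j))].
have [|g gP] := @exists_notin_union _ _ s B.
  have N0 : (0 < #|{ffun 'I_k -> {ffun I -> 'I_Q}}|)%N.
    by rewrite !card_ffun !card_ord !expn_gt0 -(ltr_nat R) Q0.
  rewrite -(ltr_nat R) -[ltRHS]mul1r natr_sum.
  apply: le_lt_trans (_ : (\sum_(j <- s) (3 * t j / tau j) ^+ k) *
     #|{ffun 'I_k -> {ffun I -> 'I_Q}}|%:R < _); last by rewrite ltr_pM2r ?ltr0n.
  rewrite mulr_suml !big_seq; apply: ler_sum => j js.
  rewrite cardsE card_ffun_on card_ord [X in _ * X%:R]card_ffun card_ord.
  by rewrite !natrX -exprMn lerXn2r ?nnegrE ?cardE // (le_trans _ (cardE j js)).
exists (fun l => val (g l)); split => [l i|j js].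
  by rewrite divr_ge0 //= ler_pdivrMr // mul1r ler_nat ltnW.
have := gP j js; rewrite inE => /ffun_onP nE; apply/existsP.
apply: contra_notT nE => /existsPn far l; rewrite inE ltNge; exact: far.
Qed.

Local Open Scope classical_set_scope.
Local Open Scope ring_scope.

(** * The map at finitely many scales *)

Lemma mdist_diff (R : realType) (X : metricType R) (a x y : X) :
  `|mdist x a - mdist y a| <= mdist x y.
Proof.
have := metric_triangle x y a; have := metric_triangle y x a.
by rewrite (metric_sym y x) ler_norml; lra.
Qed.

(** Pairs of [B n] are separated by [(1 + 2 * L) * delta n], because moving [x] and [y] to points of
    [B n] costs at most [L * delta n] each. Some coefficient has influence at least
    [w n * eps n / 4]; three times the quotient of these is the base of the power [k]. *)
Lemma finite_scales (R : realType) (X : metricType R) (k M : nat)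
    (eps delta w : nat -> R) (A B : nat -> {fset X}) (L : R) :
  (forall n, 0 < eps n) -> (forall n, 0 < delta n) -> (forall n, 0 < w n) ->
  (forall n, 4 * delta n <= eps n) ->
  (forall n x, exists2 a, a \in A n & mdist a x < eps n / 8) ->
  (forall n x, exists2 b, b \in B n & mdist b x < delta n) ->
  \sum_(0 <= n < M) w n * #|` A n|%:R <= L ->
  \sum_(0 <= n < M) #|` B n|%:R ^+ 2 *
    (12 * (1 + 2 * L) * delta n / (w n * eps n)) ^+ k < 1 ->
  exists psi : 'I_k -> X -> R,
    (forall l x y, `|psi l x - psi l y| <= L * mdist x y) /\
    forall n x y, (n < M)%N -> eps n <= mdist x y ->
      exists l, delta n <= `|psi l x - psi l y|.
Proof.
move=> eps0 delta0 w0 delta_eps netA netB sumL small.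
pose r := [seq (n, a) | n <- index_iota 0 M, a <- enum_fset (A n)].
pose u (p : nat * X) x := w p.1 * mdist x p.2.
pose U (i : 'I_(size r)) := u (tnth (in_tuple r) i).
pose s := [seq (n, b) | n <- index_iota 0 M,
             b <- [seq (p, q) | p <- enum_fset (B n), q <- enum_fset (B n)]].
(* Net points near [x] and [y] stay [eps n / 2] apart, as [2 * delta n <= eps n / 2]. *)
pose s' := [seq j <- s | eps j.1 / 2 <= mdist j.2.1 j.2.2].
pose v (j : nat * (X * X)) i := U i j.2.1 - U i j.2.2.
have L0 : 0 <= L.
  by apply: le_trans sumL; apply: sumr_ge0 => n _; rewrite mulr_ge0 // ltW.
have [|||| c [c01 cs]] := @exists_coefficients R k _ _ s' v
  (fun j => (1 + 2 * L) * delta j.1) (fun j => w j.1 * eps j.1 / 4).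
- by move=> j _; rewrite mulr_gt0 //; lra.
- by move=> j _; rewrite divr_gt0 // mulr_gt0.
- move=> [n [p q]]; rewrite mem_filter /= => /andP[far].
  move=> /allpairsPdep[n' [b [nM _ [? _]]]]; subst n'.
  (* For [a] this close to [p], [mdist q a - mdist p a] is at least
     [eps n / 2 - 2 * (eps n / 8) = eps n / 4]. *)
  have [a aA pa] := netA n p.
  have : (n, a) \in r by apply/allpairsPdep; exists n, a.
  move=> /(tnthP (in_tuple r))[i ia]; exists i.
  rewrite /v /U -ia /u /= -mulrBr normrM gtr0_norm // -mulrA ler_pM2l //.
  have := metric_triangle p a q; rewrite (metric_sym p a) (metric_sym a q).
  rewrite ler_normr; have := eps0 n; lra.
- apply: le_lt_trans small; rewrite big_filter.
  apply: le_trans (_ : \sum_(j <- s) (12 * (1 + 2 * L) * delta j.1 /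
                         (w j.1 * eps j.1)) ^+ k <= _).
    rewrite big_mkcond; apply: ler_sum => j _; case: ifP => _; last first.
      rewrite exprn_ge0 // divr_ge0 ?mulr_ge0 //; try exact: ltW; lra.
    rewrite le_eqVlt; apply/orP; left; apply/eqP; congr (_ ^+ _).
    have := eps0 j.1; have := w0 j.1 => ? ?; field.
    by rewrite !gt_eqF.
  rewrite big_allpairs_dep /= ler_sum // => n _.
  rewrite big_const_seq count_predT size_allpairs iter_addr_0.
  by rewrite -[leLHS]mulr_natl natrM.
have Usum : \sum_i w (tnth (in_tuple r) i).1 <= L.
  rewrite -(big_tnth _ _ r xpredT (fun p => w p.1)) big_allpairs_dep /=.
  apply: le_trans sumL; apply: ler_sum => n _.
  by rewrite big_const_seq count_predT iter_addr_0 -[leLHS]mulr_natr.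
pose psi l x := \sum_i c l i * U i x.
have psiB l x y : psi l x - psi l y = \sum_i c l i * (U i x - U i y).
  by rewrite -sumrB; apply: eq_bigr => i _; rewrite mulrBr.
have psiL l x y : `|psi l x - psi l y| <= L * mdist x y.
  rewrite psiB; apply: le_trans (ler_norm_sum _ _ _) _.
  apply: le_trans (ler_wpM2r (mdist_ge0 x y) Usum); rewrite mulr_suml.
  apply: ler_sum => i _; have /andP[c0 c1] := c01 l i.
  rewrite normrM ger0_norm // -[leRHS]mul1r ler_pM //.
  by rewrite /U /u -mulrBr normrM gtr0_norm // ler_pM2l // mdist_diff.
exists psi; split=> // n x y nM xy.
have [p pB px] := netB n x; have [q qB qy] := netB n y.
have := metric_triangle x p y; have := metric_triangle p q y.
rewrite (metric_sym x p) => tri1 tri2.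
have js : (n, (p, q)) \in s'.
  rewrite mem_filter /=; apply/andP; split; first by have := delta_eps n; lra.
  apply/allpairsPdep; exists n, (p, q); split => //.
    by rewrite mem_index_iota.
  by apply/allpairsP; exists (p, q).
have [l] := cs _ js; rewrite -psiB /= => far; exists l.
have Lx := psiL l p x; have Ly := psiL l q y.
have Lx' : L * mdist p x <= L * delta n by rewrite ler_wpM2l // ltW.
have Ly' : L * mdist q y <= L * delta n by rewrite ler_wpM2l // ltW.
have : `|psi l p - psi l q| <=
    `|psi l p - psi l x| + `|psi l x - psi l y| + `|psi l q - psi l y|.
  rewrite (distrC (psi l q)).
  apply: le_trans (_ : `|(psi l p - psi l x + (psi l x - psi l y)) +
                         (psi l y - psi l q)| <= _).
    by rewrite le_eqVlt; apply/orP; left; apply/eqP; congr `|_|; ring.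
  by apply: le_trans (ler_normD _ _) _; rewrite lerD2r ler_normD.
lra.
Qed.

(** * Passage to all scales *)

(** Compactness of [[- b, b]] gives a cluster point, and an ultrafilter converges to each of its
    cluster points. *)
Lemma ultra_bounded_cvg (R : realType) (T : Type) (U : set_system T)
    (f : T -> R) (b : R) :
  UltraFilter U -> (forall t, `|f t| <= b) -> exists p : R, f @ U --> p.
Proof.
move=> UU fb; have [|p [_ clp]] := @segment_compact R (- b) b (f @ U) _.
  by apply: nearW => t; rewrite /= in_itv /= -ler_norml.
exists p => V /= Vp; have [//|VCU] := in_ultra_setVsetC (f @^-1` V) UU.
by have [|t []] := clp (~` V) V _ Vp.
Qed.

(** The values [psi M l x] need not be bounded in [M], but after subtraction of the value at a base
    point [x0] they are bounded by [L * mdist x x0]. One ultrafilter then gives limits at all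
    points. *)
Lemma equilipschitz_limit (R : realType) (X : metricType R) (k : nat)
    (psi : nat -> 'I_k -> X -> R) (L : R) :
  (forall M l x y, `|psi M l x - psi M l y| <= L * mdist x y) ->
  exists phi : 'I_k -> X -> R,
    (forall l x y, `|phi l x - phi l y| <= L * mdist x y) /\
    forall x y d,
      (\forall M \near \oo, exists l, d <= `|psi M l x - psi M l y|) ->
      exists l, d <= `|phi l x - phi l y|.
Proof.
move=> psiL.
have [[x0 _]|X0] := pselect (exists x : X, True); last first.
  by exists (fun _ _ => 0); split=> *; exfalso; apply: X0; eexists.
have [U [UU subU]] := @ultraFilterLemma nat \oo _.
have /choice[phi phiP] : forall lx : 'I_k * X, exists p : R,
    psi M lx.1 lx.2 - psi M lx.1 x0 @[M --> U] --> p.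
  by move=> [l x]; apply: ultra_bounded_cvg => M; exact: psiL.
have diff l x y :
    `|psi M l x - psi M l y| @[M --> U] --> `|phi (l, x) - phi (l, y)|.
  have -> : (fun M => `|psi M l x - psi M l y|) = (fun M => `|
      ((fun M => psi M l x - psi M l x0) - (fun M => psi M l y - psi M l x0)) M|).
    apply/funext => M; rewrite -[((_ - _) : _ -> _) M]/(_ M - _ M) /=.
    by congr `|_|; ring.
  exact: cvg_norm (cvgB (phiP (l, x)) (phiP (l, y))).
exists (fun l x => phi (l, x)); split=> [l x y|x y d far].
  by apply: cvgr_to_le (diff l x y) _; apply: nearW => M; exact: psiL.
apply: contrapT => close.
(* The separating index [l] may vary with [M]; since there are finitely many components, strict
   bounds on all of them in the limit hold jointly for [psi M] along [U]. *)
have : \forall M \near U, forall l, `|psi M l x - psi M l y| < d.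
  apply: filter_forall => l; apply: cvgr_lt (diff l x y) _ _.
  by rewrite ltNge; apply/negP => dl; apply: close; exists l.
move=> /(filterI (subU _ far))/filter_ex[M [[l dl] /(_ l)]].
by rewrite ltNge dl.
Qed.

(** * Covers from the box-counting dimension *)

Lemma box_dim_cover (R : realType) (X : metricType R) (s : R) :
  (box_dim X < s%:E)%E ->
  exists2 e0 : R, 0 < e0 & forall e, 0 < e < e0 -> exists2 A : {fset X},
    #|` A|%:R <= e `^ (- s) & forall x, exists2 a, a \in A & mdist a x < e.
Proof.
move=> /ereal_inf_lt[_ [V V0 <-] Vs].
have [e0 /= e0_gt0 e0V] : 0^'+ (V : set R) by [].
(* Radii below 1 make [- ln e] positive, so the bound on the quotient can be multiplied out. *)
exists (Num.min e0 1) => [|e]; first by rewrite lt_min e0_gt0 ltr01.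
rewrite lt_min => /and3P[e_gt0 ee0 e1].
have Ve : V e.
  by apply: e0V => //=; rewrite sub0r normrN gtr0_norm.
have lne0 : 0 < - ln e by rewrite oppr_gt0 ln_lt0 ?e_gt0.
have : (covering_number X e < (e `^ (- s))%:E)%E.
  have : (lne (covering_number X e) * ((- ln e)^-1)%:E < s%:E)%E.
    by apply: le_lt_trans Vs; apply: ereal_sup_ubound; exists e.
  rewrite lte_pdivrMr // -EFinM.
  have -> : e `^ (- s) = expR (s * - ln e).
    by rewrite /powR gt_eqF // mulrN -mulNr.
  case: (covering_number X e) => [r| |] //=; last by rewrite !ltNyr.
  case: ifPn => [r0 _|]; first by rewrite lte_fin (le_lt_trans r0) ?expR_gt0.
  by rewrite -ltNge !lte_fin => r0; rewrite -ltr_expR lnK.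
move=> /ereal_inf_lt[_ [A coverA <-]]; rewrite lte_fin => cardA.
exists A => [|x]; first exact: ltW.
by have [a aA] := coverA x I; rewrite ballEmdist; exists a.
Qed.

Lemma box_dim_ge0 (R : realType) (X : metricType R) (x : X) :
  (0 <= box_dim X)%E.
Proof.
rewrite leNgt; apply/negP => dim_lt0.
have [s s_lt0 dim_s] : exists2 s : R, s < 0 & (box_dim X < s%:E)%E.
  move: (box_dim X) dim_lt0 => [r| |] //=; last by exists (-1); rewrite ?ltNyr.
  by rewrite lte_fin => r0; exists (r / 2); rewrite ?lte_fin; lra.
have [e0 e0_gt0 cover] := box_dim_cover dim_s.
pose e := Num.min e0 1 / 2.
have e_bnd : [/\ 0 < e, e < e0 & e < 1].
  have m0 : 0 < Num.min e0 1 by rewrite lt_min e0_gt0 ltr01.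
  by rewrite /e; split; case: (leP e0 1) m0; lra.
have [e_gt0 ee0 e1] := e_bnd.
have [|A cardA coverA] := cover e; first by rewrite e_gt0.
have [a aA _] := coverA x.
have : 1 <= #|` A|%:R :> R by rewrite ler1n cardfs_gt0; apply/fset0Pn; exists a.
apply/negP; rewrite -ltNge; apply: le_lt_trans cardA _.
have := powR1 R => /(congr1 (fun f => f (- s))) <-.
apply: gt0_ltr_powR; rewrite ?nnegrE ?ltW //.
by rewrite oppr_gt0.
Qed.

(** * Geometric scales and the choice of parameters *)

Lemma powR_exprn (R : realType) (a x : R) (n : nat) :
  0 <= a -> (a ^+ n) `^ x = (a `^ x) ^+ n.
Proof.
by move=> a0; rewrite -[a ^+ n]powR_mulrn // powRAC powR_mulrn ?powR_ge0.
Qed.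

Lemma sum_shifted_geometric_le (R : realFieldType) (r : R) (n0 M : nat) :
  0 <= r < 1 -> \sum_(0 <= n < M) r ^+ (n0 + n) <= r ^+ n0 / (1 - r).
Proof.
move=> /andP[r0 r1]; rewrite ler_pdivlMr ?subr_gt0 //.
suff -> : (\sum_(0 <= n < M) r ^+ (n0 + n)) * (1 - r) = r ^+ n0 * (1 - r ^+ M).
  by rewrite ler_piMr ?exprn_ge0 // gerBl exprn_ge0.
elim: M => [|M IH]; first by rewrite big_nil expr0 subrr mulr0 mul0r.
by rewrite big_nat_recr //= mulrDl IH exprD exprS; ring.
Qed.

Lemma near_expr_lt (R : realType) (r c : R) :
  0 <= r < 1 -> 0 < c -> \forall n \near \oo, r ^+ n < c.
Proof.
move=> /andP[r0 r1] c0; have := @cvg_expr R r; rewrite ger0_norm // => /(_ r1).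
by move=> /cvgr_lt; exact.
Qed.

Lemma powR_half_bounds (R : realType) (x : R) :
  0 < x -> 0 <= (2^-1 : R) `^ x < 1.
Proof.
move=> x0; rewrite powR_ge0 /=; have /(congr1 (fun f => f x)) {2}<- := powR1 R.
by apply: gt0_ltr_powR; rewrite ?nnegrE //; lra.
Qed.

(** The conditions of [finite_scales] reduce to geometric sequences: [r1] controls the Lipschitz
    sum, [r2] the union bound and [r3] the quotient [delta n / eps n]. *)
Lemma separating_scales (R : realType) (X : metricType R) (k : nat)
    (s s' theta : R) :
  (box_dim X < s%:E)%E -> 0 < s -> s < s' -> 0 < theta ->
  theta * (k%:R * (1 + s')) < k%:R - 2 * s ->
  exists n0 (L : R) (phi : 'I_k -> X -> R),
    (forall l x y, `|phi l x - phi l y| <= L * mdist x y) /\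
    forall n x y, 2^-1 ^+ (n0 + n) <= mdist x y ->
      exists l, (2^-1 ^+ (n0 + n)) `^ theta^-1 <= `|phi l x - phi l y|.
Proof.
move=> dim_s s0 ss' theta0 gap.
have k0 : 0 < k%:R :> R.
  have : 0 <= theta * (k%:R * (1 + s')).
    by rewrite !mulr_ge0 ?ler0n // ?ltW //; lra.
  lra.
have theta1 : theta < 1.
  rewrite -(ltr_pM2r k0) mul1r.
  apply: le_lt_trans (_ : _ <= k%:R - 2 * s) _ => //.
    apply: le_trans (ltW gap); rewrite ler_pM2l // ler_peMr ?ltW //; lra.
  lra.
have [e0 e0_gt0 cover] := box_dim_cover dim_s.
pose h : R := 2^-1.
have h_gt0 : 0 < h by rewrite invr_gt0.
have h0 : 0 <= h by exact: ltW.
(* The exponent of [eps n] in the union bound: [- 2 * s / theta] from the pairs of [B n] and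
   [k * (theta^-1 - (1 + s'))] from the probability. Its positivity is [gap]. *)
pose beta := (k%:R - 2 * s) / theta - k%:R * (1 + s').
have beta0 : 0 < beta by rewrite subr_gt0 ltr_pdivlMr // mulrC.
have thetaV : 0 < theta^-1 - 1 by rewrite subr_gt0 invf_gt1.
have r1P := @powR_half_bounds R (s' - s) ltac:(lra).
have r2P := powR_half_bounds beta0.
have r3P := powR_half_bounds thetaV.
rewrite -/h in r1P r2P r3P.
set r1 := h `^ (s' - s) in r1P; set r2 := h `^ beta in r2P.
set r3 := h `^ (theta^-1 - 1) in r3P.
pose L := 8 `^ s / (1 - r1); pose K := 12 * (1 + 2 * L).
have L0 : 0 <= L by rewrite divr_ge0 ?powR_ge0 //; lra.
have K0 : 0 < K ^+ k by rewrite exprn_gt0 // /K; lra.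
(* In turn: the covers exist at all scales used, [4 * delta n <= eps n], and the union bound sums to
   less than 1. *)
have [n0 [[n0e0 n0r3] n0r2]] : exists n0, (h ^+ n0 < e0 /\ r3 ^+ n0 < 1 / 4) /\
    r2 ^+ n0 < (1 - r2) / K ^+ k.
  apply: (@filter_ex _ \oo); apply: filterI; first apply: filterI.
  - by apply: near_expr_lt => //; rewrite h0 /h; lra.
  - by apply: near_expr_lt => //; lra.
  - by apply: near_expr_lt => //; rewrite divr_gt0 //; lra.
have decr (r : R) n : 0 <= r < 1 -> r ^+ (n0 + n) <= r ^+ n0.
  by move=> /andP[? /ltW ?]; rewrite exprD ler_piMr ?exprn_ge0 ?exprn_ile1.
pose eps n := h ^+ (n0 + n).
have eps_gt0 n : 0 < eps n by rewrite exprn_gt0.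
have epsE n x : eps n `^ x = (h `^ x) ^+ (n0 + n) by exact: powR_exprn.
have epsD n x y : eps n `^ (x + y) = eps n `^ x * eps n `^ y.
  by rewrite powRD // (gt_eqF (eps_gt0 n)) implybT.
pose delta n := eps n `^ theta^-1; pose w n := eps n `^ s'.
have delta_gt0 n : 0 < delta n by exact: powR_gt0.
have w_gt0 n : 0 < w n by exact: powR_gt0.
have delta_eps n : 4 * delta n <= eps n.
  have -> : delta n = eps n `^ (theta^-1 - 1) * eps n.
    by rewrite -[X in _ * X]powRr1 ?ltW // -epsD subrK.
  rewrite mulrA ler_piMl ?ltW // epsE -/r3.
  by have := decr r3 n r3P; lra.
have eps_e0 n : eps n < e0.
  by apply: le_lt_trans n0e0; apply: decr; rewrite h0 /h; lra.
have /choice[A AP] : forall n, exists A : {fset X},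
    #|` A|%:R <= (eps n / 8) `^ (- s) /\
    forall x, exists2 a, a \in A & mdist a x < eps n / 8.
  move=> n; have [|A] := cover (eps n / 8); last by exists A.
  by have := eps_e0 n; have := eps_gt0 n; lra.
have /choice[B BP] : forall n, exists B : {fset X},
    #|` B|%:R <= delta n `^ (- s) /\
    forall x, exists2 b, b \in B & mdist b x < delta n.
  move=> n; have [|B] := cover (delta n); last by exists B.
  by have := eps_e0 n; have := delta_eps n; have := delta_gt0 n; lra.
have sumL M : \sum_(0 <= n < M) w n * #|` A n|%:R <= L.
  apply: le_trans (_ : \sum_(0 <= n < M) 8 `^ s * r1 ^+ (n0 + n) <= _).
    apply: ler_sum => n _; have [cardA _] := AP n.
    apply: le_trans (ler_wpM2l (ltW (w_gt0 n)) cardA) _.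
    rewrite powRM ?invr_ge0 // ?(ltW (eps_gt0 n)) //.
    rewrite -[8^-1]powR_inv1 // -powRrM.
    by rewrite /w mulN1r opprK mulrA -epsD epsE mulrC.
  rewrite -mulr_sumr ler_wpM2l ?powR_ge0 //.
  apply: le_trans (sum_shifted_geometric_le _ _ r1P) _.
  have /andP[r1_ge0 /ltW r1_le1] := r1P.
  by rewrite ler_piMl ?invr_ge0 ?subr_ge0 // exprn_ile1.
have small M : \sum_(0 <= n < M) #|` B n|%:R ^+ 2 *
    (12 * (1 + 2 * L) * delta n / (w n * eps n)) ^+ k < 1.
  apply: le_lt_trans (_ : \sum_(0 <= n < M) K ^+ k * r2 ^+ (n0 + n) < _).
    apply: ler_sum => n _; have [cardB _] := BP n.
    rewrite -/K -mulrA exprMn mulrCA ler_wpM2l ?(ltW K0) //.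
    have -> : delta n / (w n * eps n) = eps n `^ (theta^-1 - (1 + s')).
      rewrite epsD powRN epsD powRr1 ?ltW // [w n * _]mulrC //.
    rewrite -[r2 ^+ _](epsE n beta).
    have -> : eps n `^ beta = (delta n `^ (- s)) ^+ 2 *
        eps n `^ (theta^-1 - (1 + s')) ^+ k.
      rewrite -!powR_mulrn ?powR_ge0 // -!powRrM -epsD; congr (_ `^ _).
      by rewrite /beta; field; rewrite gt_eqF.
    by rewrite ler_wpM2r ?exprn_ge0 ?powR_ge0 // lerXn2r ?nnegrE // powR_ge0.
  rewrite -mulr_sumr mulrC -ltr_pdivlMr // mul1r.
  apply: le_lt_trans (sum_shifted_geometric_le _ _ r2P) _.
  have /andP[_ r2_lt1] := r2P.
  by rewrite ltr_pdivrMr ?subr_gt0 // [ltRHS]mulrC.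
have /choice[psi psiP] M := finite_scales eps_gt0 delta_gt0 w_gt0 delta_eps
  (fun n => (AP n).2) (fun n => (BP n).2) (sumL M) (small M).
have [phi [phiL phiP]] := equilipschitz_limit (fun M => (psiP M).1).
exists n0, L, phi; split=> // n x y xy; apply: phiP.
by exists n.+1 => // M /= nM; exact: (psiP M).2.
Qed.

(** * Euclidean norm, diameter and the final estimate *)

Lemma normr_le_euclidean_norm (R : realType) (k : nat) (v : 'rV[R]_k) i :
  `|v 0 i| <= euclidean_norm v.
Proof.
rewrite -sqrtr_sqr ler_wsqrtr // (bigD1 i) //= lerDl sumr_ge0 // => j _.
exact: sqr_ge0.
Qed.

Lemma euclidean_norm_le (R : realType) (k : nat) (v : 'rV[R]_k) (b : R) :
  0 <= b -> (forall i, `|v 0 i| <= b) -> euclidean_norm v <= Num.sqrt k%:R * b.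
Proof.
move=> b0 vb; rewrite -[X in _ * X](ger0_norm b0) -sqrtr_sqr -sqrtrM ?ler0n //.
apply: ler_wsqrtr; rewrite mulr_natl -[X in _ *+ X](card_ord k) -sumr_const.
by apply: ler_sum => i _; rewrite -real_normK ?num_real // lerXn2r ?nnegrE.
Qed.

Lemma box_dim_bounded (R : realType) (X : metricType R) (s : R) :
  (box_dim X < s%:E)%E -> exists2 D : R, 0 < D & forall x y : X, mdist x y <= D.
Proof.
move=> /box_dim_cover[e0 e0_gt0 cover].
have [[x0 _]|X0] := pselect (exists x : X, True); last first.
  by exists 1 => // x; exfalso; apply: X0; exists x.
have [|A _ coverA] := cover (e0 / 2); first by lra.
(* The sum serves as an upper bound for the largest distance from a centre to [x0]. *)
pose D := e0 / 2 + \sum_(a <- enum_fset A) mdist a x0.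
have sum_ge0 (r : seq X) : 0 <= \sum_(a <- r) mdist a x0.
  by apply: sumr_ge0 => a _; exact: mdist_ge0.
have D0 : 0 < D by have := sum_ge0 (enum_fset A); rewrite /D; lra.
have Dx x : mdist x x0 <= D.
  have [a aA ax] := coverA x; apply: le_trans (metric_triangle x a x0) _.
  rewrite (metric_sym x a); apply: lerD; first exact: ltW.
  by rewrite (big_rem a) //= lerDl; exact: sum_ge0.
exists (D + D) => [|x y]; first exact: addr_gt0.
by apply: le_trans (metric_triangle x x0 y) _; rewrite (metric_sym x0) lerD.
Qed.

Theorem corollary2p6 (R : realType) (X : metricType R)
    (compactX : compact [set: X])
    (dB : R) (dBE : box_dim X = dB%:E)
    (k : nat) (k_gt : 2 * dB < k%:R)
    (theta : R) (theta_gt0 : 0 < theta)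
    (theta_lt : theta < (k%:R - 2 * dB) / (k%:R * (1 + dB) * (1 + dB / 2))) :
  exists (psi : X -> 'rV[R]_k) (C : R),
    [/\ lipschitz_map psi,
        0 < C
      & forall x y : X,
          mdist x y <= C * euclidean_norm (psi x - psi y) `^ theta].
Proof.
have [[x0 _]|X0] := pselect (exists x : X, True); last first.
  exists (fun _ => 0), 1; split=> // [|x]; last by exfalso; apply: X0; exists x.
  by exists 0 => // x; exfalso; apply: X0; exists x.
have dB0 : 0 <= dB by rewrite -lee_fin -dBE; exact: box_dim_ge0 x0.
have theta_neq0 : theta != 0 by rewrite gt_eqF.
have k0 : 0 < k%:R :> R by lra.
have k1dB : 0 < k%:R * (1 + dB) by rewrite mulr_gt0 //; lra.
have gap : theta * (k%:R * (1 + dB)) < k%:R - 2 * dB.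
  move: theta_lt; rewrite ltr_pdivlMr; last by rewrite mulr_gt0 //; lra.
  apply: le_lt_trans; rewrite [X in _ <= X]mulrA ler_peMr //; last lra.
  by rewrite mulr_ge0 // ltW.
pose g := k%:R - 2 * dB - theta * (k%:R * (1 + dB)).
have tk0 : 0 < theta * k%:R by exact: mulr_gt0.
(* Taking [s = dB + eta] and [s' = dB + 2 * eta] uses up [2 * eta * (1 + theta * k) = g / 2] of the
   slack [g]. *)
pose eta := g / (4 * (1 + theta * k%:R)).
have eta0 : 0 < eta by rewrite divr_gt0 ?mulr_gt0 // /g; lra.
have etaE : eta * (4 * (1 + theta * k%:R)) = g.
  by rewrite /eta divfK // gt_eqF //; lra.
have dim_s : (box_dim X < (dB + eta)%:E)%E by rewrite dBE lte_fin ltrDl.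
have [n0 [L [phi [phiL phi_far]]]] : exists n0 (L : R) (phi : 'I_k -> X -> R),
    (forall l x y, `|phi l x - phi l y| <= L * mdist x y) /\
    forall n x y, 2^-1 ^+ (n0 + n) <= mdist x y ->
      exists l, (2^-1 ^+ (n0 + n)) `^ theta^-1 <= `|phi l x - phi l y|.
  apply: (@separating_scales _ _ _ (dB + eta) (dB + 2 * eta)) => //; try lra.
  have -> : theta * (k%:R * (1 + (dB + 2 * eta))) =
    theta * (k%:R * (1 + dB)) + 2 * eta * (theta * k%:R) by ring.
  by move: etaE; rewrite /g mulrDr mulr1; nra.
have [D D0 diam] := box_dim_bounded dim_s.
pose psi x : 'rV[R]_k := \row_l phi l x.
pose N x y := euclidean_norm (psi x - psi y).
have psiE x y l : (psi x - psi y) 0 l = phi l x - phi l y by rewrite !mxE.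
have N_far n x y : 2^-1 ^+ (n0 + n) <= mdist x y ->
    2^-1 ^+ (n0 + n) <= N x y `^ theta.
  move=> /phi_far[l far].
  have eps0 : 0 <= 2^-1 ^+ (n0 + n) :> R by rewrite exprn_ge0 // invr_ge0.
  have -> : 2^-1 ^+ (n0 + n) = ((2^-1 ^+ (n0 + n)) `^ theta^-1) `^ theta :> R.
    by rewrite -powRrM mulVf // powRr1.
  apply: ge0_ler_powR;
    rewrite ?nnegrE ?powR_ge0 ?sqrtr_ge0 ?(ltW theta_gt0) //.
  by apply: le_trans far _; rewrite -psiE normr_le_euclidean_norm.
pose eps0 : R := 2^-1 ^+ n0.
have eps0_gt0 : 0 < eps0 by rewrite exprn_gt0 // invr_gt0.
(* [D / eps0] serves the distances from [eps0] up to the diameter bound [D], and 2, the ratio of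
   consecutive scales, the smaller ones. *)
exists psi, (2 + D / eps0); split.
(* The sign of [L] is not recorded, hence the absolute value. *)
- exists (Num.sqrt k%:R * `|L|) => [|x y]; first by rewrite mulr_ge0 ?sqrtr_ge0.
  rewrite -mulrA; apply: euclidean_norm_le; first by rewrite mulr_ge0 ?mdist_ge0.
  move=> l; rewrite psiE; apply: le_trans (phiL l x y) _.
  by rewrite ler_wpM2r ?mdist_ge0 ?ler_norm.
- by rewrite addr_gt0 // divr_gt0.
- move=> x y; rewrite -/(N x y) mulrDl.
  have P0 : 0 <= N x y `^ theta by exact: powR_ge0.
  have DP0 : 0 <= D / eps0 * N x y `^ theta.
    by rewrite mulr_ge0 // divr_ge0 // ltW.
  have [le_eps0|lt_eps0] := leP eps0 (mdist x y).
    have := @N_far 0 x y; rewrite addn0 => /(_ le_eps0) far.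
    apply: le_trans (diam x y) _.
    have : D / eps0 * eps0 <= D / eps0 * N x y `^ theta.
      by rewrite ler_wpM2l // divr_ge0 // ltW.
    by rewrite divfK ?gt_eqF //; lra.
  have [xy|xy] := eqVneq x y.
    have -> : mdist x y = 0 by rewrite xy mdistxx.
    by rewrite addr_ge0 // mulr_ge0.
  have xy0 : 0 < mdist x y by rewrite mdist_gt0.
  have ex_n : exists n, 2^-1 ^+ (n0 + n) <= mdist x y.
    have [n ltn] : exists n, (2^-1 : R) ^+ n < mdist x y.
      by apply: (@filter_ex _ \oo); apply: near_expr_lt => //; lra.
    exists n; apply: le_trans (ltW ltn); rewrite exprD ler_piMl ?exprn_ge0 //;
      by rewrite ?exprn_ile1 //; lra.
  (* At the first scale not exceeding [mdist x y], the preceding scale, twice as large, exceeds it.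
     Index 0 is excluded by [lt_eps0]. *)
  case: (ex_minnP ex_n) => -[|n] near_n minn.
    by move: near_n; rewrite addn0 leNgt lt_eps0.
  have far := N_far _ _ _ near_n.
  have : mdist x y < 2^-1 ^+ (n0 + n).
    by rewrite ltNge; apply/negP => /minn; rewrite ltnn.
  by move: far; rewrite addnS exprS; lra.
Qed.
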